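(* Let $M^n$ be a closed hypersurface in the unit sphere $S^{n+1}$. Suppose the following conditions are satisfied: (i) the number $g$ of distinct principal curvatures is a constant and $g<n$; (ii) for each $k=1,\dots,g$, the $k$-th power sum of the principal curvatures, $\sum_{i=1}^n\lambda_i^k$, is constant, where $\lambda_1,\dots,\lambda_n$ are the principal curvatures counted with multiplicity. Then $M^n$ is isoparametric.
   Context: Closed means compact without boundary. The principal curvatures are the eigenvalues of the shape operator, i.e. of the $(1,1)$ tensor field dual to the second fundamental form, with respect to a unit normal field. A hypersurface in $S^{n+1}$ is called isoparametric if all its principal curvatures are constant.
   Formalization: The closed hypersurface M^n is assumed connected; without this the claim fails, e.g. for the disjoint union of the minimal Clifford tori S^1×S^3 and S^2×S^2 immersed in S^5 (g=2, power sums 0 and 4 on both). *)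

(* Defs.v *)
From HB Require Import structures.
From mathcomp Require Export all_boot all_order all_algebra.
From mathcomp Require Export all_classical all_reals topology normedtype derive.
From mathcomp Require Export polyrcf.

Set Implicit Arguments.
Unset Strict Implicit.
Unset Printing Implicit Defensive.

Import Order.TTheory GRing.Theory Num.Theory.
Import numFieldNormedType.Exports.

Local Open Scope classical_set_scope.
Local Open Scope ring_scope.

Section Calculus.
Variables (R : realType) (n m : nat).
Implicit Types (f : 'rV[R]_n -> 'rV[R]_m) (i : 'I_n).

Definition partial i f : 'rV[R]_n -> 'rV[R]_m :=
  fun x => 'D_(delta_mx 0 i) f x.

(* C^oo: every iterated partial derivative (f itself for s = [::]) is Frechet
   differentiable at every point of U, hence exists and is continuous on U. *)
Definition smooth_on (U : set 'rV[R]_n) f :=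
  forall (s : seq 'I_n) x, U x -> differentiable (foldr partial f s) x.

End Calculus.

Definition dot (R : realType) (m : nat) (u v : 'rV[R]_m) : R :=
  \sum_(i < m) u 0 i * v 0 i.

(* A smooth structure of dimension n on M.  The maps coord c : M -> R^n and
   param c : R^n -> M are mutually inverse homeomorphisms between the open sets
   dom c and img c; their values elsewhere are irrelevant.  The charts cover M,
   the covering being witnessed by a choice of a chart around each point. *)
Record smooth_atlas (R : realType) (n : nat) (M : topologicalType) := SmoothAtlas {
  chart : Type;
  dom : chart -> set M;
  img : chart -> set 'rV[R]_n;
  coord : chart -> M -> 'rV[R]_n;
  param : chart -> 'rV[R]_n -> M;
  chart_at : M -> chart;
  dom_chart_at : forall p, dom (chart_at p) p;
  open_dom : forall c, open (dom c);
  open_img : forall c, open (img c);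
  coord_img : forall c p, dom c p -> img c (coord c p);
  param_dom : forall c x, img c x -> dom c (param c x);
  coordK : forall c p, dom c p -> param c (coord c p) = p;
  paramK : forall c x, img c x -> coord c (param c x) = x;
  coord_continuous : forall c p, dom c p -> {for p, continuous (coord c)};
  param_continuous : forall c x, img c x -> {for x, continuous (param c)};
  transition_smooth : forall c d,
    smooth_on (img c `&` param c @^-1` dom d) (coord d \o param c)
}.

Section Hypersurfaces.
Variables (R : realType) (n : nat) (M : topologicalType).
Variable A : smooth_atlas R n M.

(* Compactness and local Euclideanness give second countability. *)
Definition closed_connected_manifold :=
  [/\ hausdorff_space M, compact [set: M] & connected [set: M]].

Definition smooth_map (m : nat) (F : M -> 'rV[R]_m) :=
  forall c : chart A, smooth_on (img c) (F \o param c).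

Implicit Types F nu : M -> 'rV[R]_n.+2.

(* The unit sphere S^{n+1} sits in R^{n+2}; the rows of the Jacobian matrix
   'J (F \o param c) x are the partial derivatives of F \o param c at x. *)
Definition hypersurface_of_sphere F :=
  [/\ smooth_map F,
      forall p, dot (F p) (F p) = 1 &
      forall (c : chart A) x, img c x -> row_free ('J (F \o param c) x)].

(* Normal to the hypersurface and tangent to the sphere. *)
Definition unit_normal_field F nu :=
  [/\ smooth_map nu,
      forall p, dot (nu p) (nu p) = 1,
      forall p, dot (nu p) (F p) = 0 &
      forall (c : chart A) x i, img c x ->
        dot (nu (param c x)) (partial i (F \o param c) x) = 0].

Definition first_fundamental_form F (c : chart A) (x : 'rV[R]_n) : 'M[R]_n :=
  \matrix_(i, j) dot (partial i (F \o param c) x) (partial j (F \o param c) x).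

(* The Levi-Civita connection of the sphere differs from the flat derivative of
   R^{n+2} by a multiple of F, which is orthogonal to nu. *)
Definition second_fundamental_form F nu (c : chart A) (x : 'rV[R]_n) : 'M[R]_n :=
  \matrix_(i, j) dot (partial i (partial j (F \o param c)) x) (nu (param c x)).

Definition shape_operator F nu (c : chart A) (x : 'rV[R]_n) : 'M[R]_n :=
  invmx (first_fundamental_form F c x) *m second_fundamental_form F nu c x.

(* In increasing order, each repeated according to its multiplicity as a root
   of the characteristic polynomial. *)
Definition real_eigenvalues (S : 'M[R]_n) : seq R :=
  flatten [seq nseq (mup x (char_poly S)) x | x <- rootsR (char_poly S)].

(* The eigenvalues do not depend on the chart around p. *)
Definition principal_curvatures F nu (p : M) : seq R :=
  let c := chart_at A p in real_eigenvalues (shape_operator F nu c (coord c p)).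

Definition isoparametric F nu :=
  exists s : seq R, forall p, principal_curvatures F nu p = s.

End Hypersurfaces.

(* Main.v *)
Require Import Defs.
From mathcomp Require Import landau complex ring lra.

(** The theorem holds because the principal curvatures, listed with their
    multiplicities, are locally constant; a closed connected manifold then
    leaves no room for them to vary.

    The algebraic core is [power_sums_isolated].  Write a multiset of reals
    with [g] distinct values as [mu_1, ..., mu_g] with multiplicities
    [m_1, ..., m_g].  The power sums [sum_i m_i mu_i^k] for [k = 1, ..., g]
    depend on the values [mu_i] with a Jacobian matrix [(k m_i mu_i^(k-1))], a
    Vandermonde matrix up to invertible factors.  Hence, for fixed
    multiplicities, the values are isolated among the solutions of the power
    sum equations; and the multiplicities cannot jump either, since the power
    sums of exponents [0, ..., g-1] determine them, by the same Vandermonde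
    matrix, as continuous functions of the values.  In the proof, Lagrange
    interpolation polynomials at the [mu_i] and their antiderivatives replace
    the inverse of the Vandermonde matrix.  No smooth, or even continuous,
    choice of the individual curvatures is ever made.

    It remains to see that nearby points have nearby curvatures.  In a chart the
    shape operator is [I^-1 II] with [I] positive definite and [II] symmetric,
    so its characteristic polynomial has [n] real roots
    ([pencil_char_poly_splits]).  A monic polynomial with only real roots that
    is small at [mu] has a root close to [mu] ([root_near]), so it suffices that
    the value at [mu] of the characteristic polynomial varies continuously; this
    value is [det (mu I - II) / det I].

    The symmetry of [II] is the equality of mixed partial derivatives
    ([derive_comm]).  As the curvatures at each point are computed in a chart
    chosen at that point, their comparison at nearby points also needs that the
    characteristic polynomial does not depend on the chart.  Differentiating
    [<nu, d_j F> = 0] gives [II = - (D nu) (D F)^T], an expression of first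
    order, so that [I] and [II] both transform by congruence with the Jacobian
    matrix of the transition map. *)

Set Implicit Arguments.
Unset Strict Implicit.
Unset Printing Implicit Defensive.

Import Order.TTheory GRing.Theory Num.Theory.
Import numFieldNormedType.Exports.

Local Open Scope ring_scope.

(** * Rigidity of multisets with few distinct values *)

Lemma eq_power_sums_horner (R : comNzRingType) (s t : seq R) (d : nat) (P : {poly R}) :
    (forall k : nat, (k <= d)%N ->
       \sum_(x <- t) x ^+ k = \sum_(x <- s) x ^+ k) ->
    (size P <= d.+1)%N ->
  \sum_(x <- t) P.[x] = \sum_(x <- s) P.[x].
Proof.
move=> st Pd.
have E (r : seq R) :
    \sum_(x <- r) P.[x] = \sum_(i < d.+1) P`_i * \sum_(x <- r) x ^+ i.
  under eq_bigr => x _ do rewrite (horner_coef_wide x Pd).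
  by rewrite exchange_big /=; apply: eq_bigr => i _; rewrite mulr_sumr.
by rewrite !E; apply: eq_bigr => i _; rewrite st // -ltnS.
Qed.

Lemma antiderivative_exists (R : realFieldType) (p : {poly R}) :
  exists2 P : {poly R}, P^`() = p & (size P <= (size p).+1)%N.
Proof.
exists (\poly_(i < (size p).+1) (p`_i.-1 / i%:R)); last exact: size_poly.
apply/polyP => i; rewrite coef_deriv coef_poly ltnS /=.
case: ltnP => [_|le_pi]; last by rewrite mul0rn nth_default.
by rewrite -[LHS]mulr_natr divfK // pnatr_eq0.
Qed.

Lemma lagrange_exists (R : fieldType) (s : seq R) (a : R) :
    uniq s -> a \in s ->
  exists2 L : {poly R}, (size L <= size s)%N &
    {in s, forall b, L.[b] = (a == b)%:R}.
Proof.
move=> us sa.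
pose Q := \prod_(b <- rem a s) ('X - b%:P); have rootQ b : root Q b = (b \in rem a s).
  exact: root_prod_XsubC.
have Qa : Q.[a] != 0 by rewrite -/(root Q a) rootQ mem_rem_uniqF.
exists (Q.[a]^-1 *: Q).
  apply: leq_trans (size_scale_leq _ _) _.
  by rewrite size_prod_XsubC size_rem //; case: (s) sa.
move=> b sb; rewrite hornerZ; have [<-|nab] := eqVneq a b.
  by rewrite mulVf.
have /eqP -> : root Q b by rewrite rootQ mem_rem_uniq // !inE eq_sym nab.
by rewrite mulr0.
Qed.

Lemma sum_undup (T : eqType) (V : nmodType) (s : seq T) (f : T -> V) :
  \sum_(x <- s) f x = \sum_(x <- undup s) f x *+ count_mem x s.
Proof. by rewrite -big_undup_iterop_count. Qed.

(** The mean value theorem, with an intermediate point that is only located near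
    [a], so that the order of [a] and [b] does not matter. *)
Lemma horner_MVT (R : realType) (P : {poly R}) (a b e : R) :
  `|b - a| < e -> exists2 c, `|c - a| < e & P.[b] - P.[a] = P^`().[c] * (b - a).
Proof.
move=> bae.
have D x : is_derive x (1 : R) (horner P) P^`().[x] by exact: is_derive_poly.
have C (x y : R) : {within `[x, y], continuous (horner P)}%classic.
  by apply: continuous_subspaceT; exact: continuous_horner.
have [ab|ba] := leP a b.
  have [c /itvP cab E] := MVT_segment ab (fun x _ => D x) (C a b).
  exists c => //; apply: le_lt_trans bae.
  by rewrite !ger0_norm ?subr_ge0 ?lerD2r ?cab.
have [c /itvP cab E] := MVT_segment (ltW ba) (fun x _ => D x) (C b a).
exists c; last by rewrite -opprB E -mulrN opprB.
apply: le_lt_trans bae.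
by rewrite distrC (distrC b) !ger0_norm ?subr_ge0 ?lerB ?cab // ltW.
Qed.

Lemma horner_near_finite (R : realType) (I J : finType) (L : I -> {poly R})
    (x : J -> R) (eta : R) : 0 < eta ->
  exists2 e, 0 < e & forall i j y, `|y - x j| < e -> `|(L i).[y] - (L i).[x j]| < eta.
Proof.
move=> eta0.
have : \forall e \near at_right (0 : R), forall i j y,
    `|y - x j| < e -> `|(L i).[y] - (L i).[x j]| < eta.
  apply: filter_forall => i; apply: filter_forall => j.
  have /cvgrPdist_lt/(_ _ eta0) := @continuous_horner R (L i) (x j).
  move=> /nbhs_ballP[d /= d0 dP].
  near=> e => y ye; rewrite distrC; apply: dP.
  rewrite /ball /= distrC; apply: lt_trans ye _.
  by near: e; exact: nbhs_right_lt.
by move=> /(filterI (nbhs_right_gt 0)) /filter_ex[e [e0 eP]]; exists e.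
Unshelve. all: by end_near. Qed.

(** With [L a] the Lagrange polynomial that is [1] at [a] and [0] at the other
    values of [s], and [phi] the bijection from the values of [s] to the nearby
    values of [t]: testing the equality of power sums on [L a], whose sum over
    [s] is the multiplicity of [a], shows that [phi] preserves multiplicities,
    since these are integers; testing it on an antiderivative of [L a], which
    picks out the displacement [phi a - a] up to a small proportion of the total
    displacement, shows that [phi] is the identity. *)
Lemma power_sums_isolated (R : realType) (s : seq R) :
  exists2 e : R, 0 < e &
    forall t : seq R,
      (size (undup t) <= size (undup s))%N ->
      (forall k : nat, (k <= size (undup s))%N ->
         \sum_(x <- t) x ^+ k = \sum_(x <- s) x ^+ k) ->
      (forall x, x \in s -> exists2 y, y \in t & `|y - x| < e) ->
    perm_eq t s.
Proof.
set mu := undup s; set g := size mu.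
have umu : uniq mu by exact: undup_uniq.
pose a (i : 'I_g) := nth 0 mu i.
have amu i : a i \in mu by rewrite mem_nth.
have aE b : b \in mu -> exists i, b = a i.
  by move=> /(nthP 0)[i ig <-]; exists (Ordinal ig).
have /choice[L LP] : forall i, exists L : {poly R},
    (size L <= g)%N /\ {in mu, forall b, L.[b] = (a i == b)%:R}.
  by move=> i; have [L] := lagrange_exists umu (amu i); exists L.
(* The bound has to be at most 1/2 for phi to be injective, and less than
   1 / size s for the errors, summed with multiplicity, to stay below 1. *)
have eta0 : 0 < (size s).+2%:R^-1 :> R by rewrite invr_gt0 ltr0n.
have [e e0 eP] := horner_near_finite L a eta0.
set eta : R := _^-1 in eta0 eP.
exists e => // t tg st near_t.
have {}eP i b y : b \in mu -> `|y - b| < e -> `|(L i).[y] - (a i == b)%:R| < eta.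
  by move=> /[dup] /aE[j ->] mb yb; have := eP i j y yb; rewrite ((LP i).2 _ mb).
have /choice[phi phiP] : forall x, exists y, x \in mu -> y \in t /\ `|y - x| < e.
  move=> x; have [|nx] := boolP (x \in mu); last by exists 0.
  by rewrite mem_undup => /near_t[y ty yx]; exists y.
have sizeE : size t = size s.
  have := st 0%N isT; under eq_bigr do rewrite expr0.
  under [RHS]eq_bigr do rewrite expr0.
  by rewrite !big_const_seq !count_predT !iter_addr_0 => /eqP; rewrite eqr_nat => /eqP.
have eta2 : eta + eta <= 1.
  by rewrite -mulr2n -mulr_natl ler_pdivrMr ?ltr0n // mul1r ler_nat.
(* Near x, the polynomial L i attached to x is closer to 1 than to 0, and near
   any other value it is closer to 0. *)
have phi_inj : {in mu &, injective phi}.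
  move=> x y mx my; have [i xi] := aE x mx => phixy; apply/eqP/negP => /negP nxy.
  have := eP i x (phi x) mx (phiP x mx).2; have := eP i y (phi y) my (phiP y my).2.
  rewrite -phixy -xi eqxx (negPf nxy) subr0 => lt1 lt2.
  have : `|(1 : R)| < 1; last by rewrite normr1 ltxx.
  rewrite -{1}[1](subrK (L i).[phi x]); apply: le_lt_trans (ler_normD _ _) _.
  by apply: lt_le_trans eta2; rewrite ltrD // distrC.
(* The images under phi are already as many as the values that t may have. *)
have perm_phi : perm_eq (undup t) (map phi mu).
  rewrite perm_sym; apply: uniq_perm; rewrite ?map_inj_in_uniq ?undup_uniq //.
  apply: (uniq_min_size _ _ _).2; rewrite ?map_inj_in_uniq ?size_map //.
  by move=> _ /mapP[x mx ->]; rewrite mem_undup; exact: (phiP x mx).1.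
pose m x := count_mem x s; pose M x := count_mem (phi x) t.
have sum_s f : \sum_(x <- s) f x = \sum_(x <- mu) f x *+ m x :> R by exact: sum_undup.
have sum_t f : \sum_(x <- t) f x = \sum_(x <- mu) f (phi x) *+ M x :> R.
  by rewrite sum_undup (perm_big _ perm_phi) big_map.
have polyE (P : {poly R}) : (size P <= g.+1)%N ->
    \sum_(x <- mu) P.[phi x] *+ M x = \sum_(x <- mu) P.[x] *+ m x.
  by move=> Pg; rewrite -sum_s -(eq_power_sums_horner st Pg) -sum_t.
have sumM : \sum_(x <- mu) (M x)%:R = (size s)%:R :> R.
  by rewrite -(sum_t (fun=> 1)) -sizeE big_const_seq count_predT iter_addr_0.
have summ : \sum_(x <- mu) (m x)%:R = (size s)%:R :> R.
  by rewrite -(sum_s (fun=> 1)) big_const_seq count_predT iter_addr_0.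
have etas : eta * (size s)%:R < 1.
  by rewrite mulrC ltr_pdivrMr ?ltr0n // mul1r ltr_nat.
have sum_delta i (f : R -> R) : \sum_(x <- mu) (a i == x)%:R * f x = f (a i).
  rewrite (bigD1_seq (a i)) //= eqxx mul1r big1 ?addr0 // => x.
  by rewrite eq_sym => /negPf ->; rewrite mul0r.
have Mm x : x \in mu -> M x = m x.
  move=> /aE[i ->].
  have := polyE (L i) (leqW (LP i).1).
  have -> : \sum_(x <- mu) (L i).[x] *+ m x = (m (a i))%:R.
    rewrite -(sum_delta i (fun x => (m x)%:R)); apply: eq_big_seq => y my.
    by rewrite (LP i).2 // mulr_natr.
  have -> : \sum_(x <- mu) (L i).[phi x] *+ M x = (M (a i))%:R +
      \sum_(x <- mu) ((L i).[phi x] - (a i == x)%:R) * (M x)%:R.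
    rewrite -(sum_delta i (fun x => (M x)%:R)) -big_split /=.
    by apply: eq_bigr => y _; rewrite -mulrDl addrC subrK mulr_natr.
  move=> Mm; have lt1 : `|(m (a i))%:R - (M (a i))%:R| < 1 :> R.
    rewrite -Mm addrC addKr; apply: le_lt_trans (ler_norm_sum _ _ _) _.
    apply: le_lt_trans etas; rewrite -sumM mulr_sumr !big_seq.
    apply: ler_sum => y my; rewrite normrM normr_nat ler_wpM2r //.
    by apply/ltW/eP => //; exact: (phiP y my).2.
  apply/eqP; move: lt1; rewrite eq_sym !pmulrn -intrB -intr_norm.
  by rewrite -[1]/(1%:~R) ltr_int -[1]add0r ltzD1 normr_le0 subr_eq0.
(* D is the total displacement, counted with multiplicity; each single
   displacement is at most eta * D, and summing these bounds forces D = 0. *)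
have phiE x : x \in mu -> phi x = x.
  pose D := \sum_(x <- mu) (m x)%:R * `|phi x - x|.
  have DE : D = \sum_(x <- mu) (m x)%:R * `|phi x - x| by [].
  have bound i : `|phi (a i) - a i| <= eta * D.
    have [P P' sP] := antiderivative_exists (L i).
    have := polyE P; rewrite (leq_trans sP) ?ltnS ?(LP i).1 // => /(_ isT).
    rewrite (eq_big_seq (fun x => P.[phi x] *+ m x)); last first.
      by move=> y my /=; rewrite Mm.
    move=> /eqP; rewrite -subr_eq0 -sumrB => /eqP.
    have : forall y, exists c, y \in mu ->
        `|c - y| < e /\ P.[phi y] - P.[y] = (L i).[c] * (phi y - y).
      move=> y; have [my|_] := boolP (y \in mu); last by exists 0.
      by have [c] := horner_MVT P (phiP y my).2; rewrite P'; exists c.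
    move=> /choice[c cP].
    rewrite (eq_big_seq (fun y => ((a i == y)%:R * ((m y)%:R * (phi y - y)))
      + ((L i).[c y] - (a i == y)%:R) * ((m y)%:R * (phi y - y)))); last first.
      move=> y my /=; rewrite -mulrDl [X in _ = X * _]addrC subrK.
      by rewrite -mulrnBl (cP y my).2 -[LHS]mulr_natr -mulrA (mulrC (phi y - y)).
    rewrite big_split /= (sum_delta i (fun y => (m y)%:R * (phi y - y))).
    move=> /eqP; rewrite addr_eq0 => /eqP E.
    have m1 : (1 <= m (a i))%N by rewrite -has_count has_pred1 -mem_undup.
    apply: (@le_trans _ _ `|(m (a i))%:R * (phi (a i) - a i)|).
      by rewrite normrM normr_nat ler_peMl ?normr_ge0 // ler1n.
    rewrite E normrN; apply: le_trans (ler_norm_sum _ _ _) _.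
    rewrite mulr_sumr !big_seq; apply: ler_sum => y my.
    rewrite !normrM normr_nat ler_wpM2r ?mulr_ge0 ?ler0n //.
    by apply/ltW/eP => //; exact: (cP y my).1.
  have D0 : D <= 0.
    have : D <= eta * (size s)%:R * D.
      rewrite mulrAC -summ mulr_sumr [leLHS]DE !big_seq.
      apply: ler_sum => y /aE[i ->].
      by rewrite mulrC ler_wpM2r ?ler0n // bound.
    rewrite -subr_le0 -{1}[D]mul1r -mulrBl pmulr_rle0 //.
    by rewrite subr_gt0.
  move=> /aE[i ->]; apply/eqP; rewrite -subr_eq0 -normr_le0.
  by apply: le_trans (bound i) _; rewrite pmulr_rle0.
have memE : t =i s.
  move=> x; rewrite -mem_undup (perm_mem perm_phi) -[RHS]mem_undup.
  by rewrite -/mu (eq_in_map _ id _).1 ?map_id // => y /phiE.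
apply/allP => x _ /=; apply/eqP.
have [sx|nsx] := boolP (x \in s).
  by have mx : x \in mu; [rewrite mem_undup | rewrite -[RHS](Mm x) // /M phiE].
by rewrite (count_memPn nsx) (count_memPn _) // memE.
Qed.

(** The value at [x] is, up to sign, the product of the distances from [x] to the
    roots. *)
Lemma root_near (R : realDomainType) (r : seq R) (x e : R) : (0 < size r)%N -> 0 <= e ->
  `|(\prod_(z <- r) ('X - z%:P)).[x]| < e ^+ size r -> exists2 y, y \in r & `|y - x| < e.
Proof.
move=> r0 e0 lt_e; apply/hasP; apply: contraTT lt_e => /hasPn far.
rewrite -leNgt horner_prod normr_prod.
have -> : e ^+ size r = \prod_(z <- r) e.
  by rewrite big_const_seq count_predT; elim: (size r) => //= k <-; rewrite exprS.
rewrite !big_seq; apply: ler_prod => z rz; rewrite e0 /= hornerXsubC distrC leNgt.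
exact: far.
Qed.

Lemma perm_real_eigenvalues (R : realType) (n : nat) (S : 'M[R]_n) (r : seq R) :
  char_poly S = \prod_(x <- r) ('X - x%:P) -> perm_eq (real_eigenvalues S) r.
Proof.
move=> Sr; rewrite /real_eigenvalues.
set p := char_poly S in Sr *.
have p0 : p != 0 by rewrite monic_neq0 // char_poly_monic.
apply: perm_trans (perm_count_undup r).
rewrite (eq_map (g := fun x => nseq (count_mem x r) x)); last first.
  by move=> x; rewrite Sr mu_prod_XsubC.
apply/perm_flatten/perm_map/uniq_perm; rewrite ?undup_uniq ?uniq_roots //.
move=> x; rewrite mem_undup -[RHS]root_prod_XsubC -Sr.
by rewrite -(roots_on_rootsR p0 x) in_itv.
Qed.

Lemma char_poly_real_eigenvalues (R : realType) (n : nat) (S : 'M[R]_n) :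
    (exists r, char_poly S = \prod_(x <- r) ('X - x%:P)) ->
  char_poly S = \prod_(x <- real_eigenvalues S) ('X - x%:P).
Proof. by move=> [r Sr]; rewrite [LHS]Sr (perm_big _ (perm_real_eigenvalues Sr)). Qed.


(** * Pencils of real symmetric matrices *)

Lemma gram_unitmx (R : realFieldType) (n m : nat) (J : 'M[R]_(n, m)) :
  row_free J -> J *m J^T \in unitmx.
Proof.
move=> Jfree; rewrite -row_free_unit -kermx_eq0; apply/rowV0P => v.
rewrite sub_kermx mulmxA => /eqP vG.
apply/eqP; rewrite -(mulmx_free_eq0 v Jfree).
have : v *m J *m (v *m J)^T = 0 by rewrite trmx_mul mulmxA vG mul0mx.
move: (v *m J) => u /matrixP/(_ 0 0); rewrite !mxE => /eqP.
rewrite psumr_eq0 => [/allP u0|i _]; last by rewrite mxE -expr2 sqr_ge0.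
apply/eqP/rowP => i; have := u0 i (mem_index_enum i).
by rewrite [u^T _ _]mxE mulf_eq0 orbb => /eqP ->; rewrite mxE.
Qed.

(** Multiplying the equation by the conjugate transpose [v] of [w] gives
    [w B v = l (w G v)] with [G = J J^T].  Both quadratic forms are real, as [B]
    and [G] are real symmetric, and [w G v], the squared norm of [w J], is
    nonzero. *)
Lemma pencil_eigenvalue_real (R : rcfType) (n m : nat) (J : 'M[R]_(n, m)) (B : 'M[R]_n)
    (w : 'rV[R[i]]_n) (l : R[i]) :
    row_free J -> B^T = B -> w != 0 ->
    w *m map_mx (real_complex R) B = l *: (w *m map_mx (real_complex R) (J *m J^T)) ->
  complex.Im l = 0.
Proof.
move=> Jfree Bsym w0 wB.
pose wc := map_mx (@conjc R) w.
have conjK (p q : nat) (A : 'M[R]_(p, q)) :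
    map_mx (@conjc R) (map_mx (real_complex R) A) = map_mx (real_complex R) A.
  by apply/matrixP => i j; rewrite !mxE; exact: conjc_real.
pose JC := map_mx (real_complex R) J.
pose N := (w *m map_mx (real_complex R) (J *m J^T) *m wc^T) 0 0.
have NE : N = \sum_i (w *m JC) 0 i * ((w *m JC) 0 i)^*%C.
  rewrite /N map_mxM -map_trmx mulmxA -mulmxA -trmx_mul.
  have -> : wc *m map_mx (real_complex R) J = map_mx (@conjc R) (w *m JC).
    by rewrite map_mxM /JC conjK.
  by rewrite mxE; apply: eq_bigr => i _; rewrite !mxE.
have N0 : N != 0.
  apply: contra w0; rewrite NE psumr_eq0 => [/allP z|i _]; last exact: mulcJ_ge0.
  rewrite -(mulmx_free_eq0 w (_ : row_free JC)); last by rewrite row_free_map.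
  apply/eqP/rowP => i; have := z i (mem_index_enum i).
  by rewrite mulf_eq0 conjc_eq0 orbb => /eqP ->; rewrite mxE.
have Nreal : N^*%C = N.
  rewrite NE rmorph_sum; apply: eq_bigr => i _.
  by rewrite rmorphM /= conjcK mulrC.
have BN : (w *m map_mx (real_complex R) B *m wc^T) 0 0 = l * N.
  by rewrite wB -scalemxAl mxE.
have BNreal : (l * N)^*%C = l * N.
  rewrite -BN; set X := _ *m _.
  have -> : (X 0 0)^*%C = (map_mx (@conjc R) X)^T 0 0 by rewrite !mxE.
  have wcK : map_mx (@conjc R) wc^T = w^T by apply/matrixP => i j; rewrite !mxE conjcK.
  by rewrite /X 2!map_mxM conjK -/wc wcK 2!trmx_mul trmxK map_trmx Bsym mulmxA.
have lreal : l^*%C = l.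
  by apply: (mulIf N0); rewrite -[in LHS]Nreal -rmorphM.
have : - complex.Im l = complex.Im l by rewrite -[in RHS]lreal; case: (l).
move=> /eqP; rewrite eq_sym -addr_eq0 -mulr2n mulrn_eq0 => /orP[//|/eqP//].
Qed.

(** Every complex root of the characteristic polynomial is an eigenvalue of the
    pencil [B - l G], hence real. *)
Lemma pencil_char_poly_splits (R : rcfType) (n m : nat) (J : 'M[R]_(n, m)) (B : 'M[R]_n) :
    row_free J -> B^T = B ->
  exists r : seq R, char_poly (invmx (J *m J^T) *m B) = \prod_(x <- r) ('X - x%:P).
Proof.
move=> Jfree Bsym; set G := J *m J^T; set S := invmx G *m B.
have Gunit : G \in unitmx by exact: gram_unitmx.
have [r Er] := closed_field_poly_normal (map_poly (real_complex R) (char_poly S)).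
rewrite lead_coef_map (monicP (char_poly_monic _)) rmorph1 scale1r in Er.
exists (map (@complex.Re R) r); apply: (map_inj_poly (@complexI R) (rmorph0 _)).
rewrite Er rmorph_prod big_map; apply: eq_big_seq => z zr.
rewrite rmorphB /= map_polyX map_polyC /=.
have : root (char_poly (map_mx (real_complex R) S)) z.
  by rewrite -map_char_poly Er root_prod_XsubC.
rewrite -eigenvalue_root_char => /eigenvalueP[v vS v0].
have GCunit : map_mx (real_complex R) G \in unitmx by rewrite map_unitmx.
pose w := v *m invmx (map_mx (real_complex R) G).
have wG : w *m map_mx (real_complex R) G = v by rewrite mulmxKV.
have Imz : complex.Im z = 0.
  apply: (@pencil_eigenvalue_real _ _ _ J B w z) => //.
    by apply: contra_neq v0 => w0; rewrite -wG w0 mul0mx.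
  by rewrite wG -vS /S map_mxM map_invmx mulmxA.
by case: z Imz {zr vS} => a b /= ->.
Qed.

(** The right-hand side is the characteristic polynomial of the pencil of [B] and
    [G]; unlike [invmx G *m B], it is polynomial in the entries and transforms
    well under congruence. *)
Lemma det_mul_char_poly (K : fieldType) (n : nat) (G B : 'M[K]_n) : G \in unitmx ->
  (\det G)%:P * char_poly (invmx G *m B)
  = \det ('X *: map_mx polyC G - map_mx polyC B).
Proof.
move=> Gunit; rewrite /char_poly /char_poly_mx -det_map_mx -det_mulmx; congr (\det _).
by rewrite mulmxBr -map_mxM mulKVmx // mul_mx_scalar.
Qed.

Lemma char_poly_congruence (K : fieldType) (n : nat) (T G B : 'M[K]_n) :
    T \in unitmx -> G \in unitmx ->
  char_poly (invmx (T *m G *m T^T) *m (T *m B *m T^T)) = char_poly (invmx G *m B).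
Proof.
move=> Tunit Gunit.
have TGT : T *m G *m T^T \in unitmx by rewrite !unitmx_mul unitmx_tr Tunit Gunit.
have dTGT : (\det (T *m G *m T^T))%:P != 0 by rewrite polyC_eq0 -unitfE -unitmxE.
apply: (mulfI dTGT); rewrite det_mul_char_poly // !map_mxM.
rewrite scalemxAl scalemxAr -mulmxBl -mulmxBr !det_mulmx -det_mul_char_poly //.
rewrite -map_trmx !det_tr det_map_mx !rmorphM /= mulrA -!mulrA; congr (_ * (_ * _)).
exact: mulrC.
Qed.

Lemma horner_char_poly (K : fieldType) (n : nat) (G B : 'M[K]_n) (l : K) : G \in unitmx ->
  (char_poly (invmx G *m B)).[l] = \det (l *: G - B) / \det G.
Proof.
move=> Gunit; have dG : \det G != 0 by rewrite -unitfE -unitmxE.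
apply: (mulfI dG); rewrite mulrCA divff // mulr1.
have := congr1 (horner_eval l) (det_mul_char_poly B Gunit).
rewrite horner_evalE hornerM hornerC -det_map_mx => ->; congr (\det _).
by apply/matrixP => i j; rewrite !mxE /= /horner_eval !hornerE.
Qed.


(** * Differential calculus *)

Section Calculus.
Variable R : realType.

Lemma is_derive_line (V : normedModType R) (f : V -> R) (p u : V) (t l : R) :
  is_derive (p + t *: u) u f l -> is_derive t 1 (fun s : R => f (p + s *: u)) l.
Proof.
move=> [df fl].
have E : (fun h : R => h^-1 *: (f (p + (h *: 1 + t) *: u) - f (p + t *: u))) =
         (fun h : R => h^-1 *: (f (h *: u + (p + t *: u)) - f (p + t *: u))).
  by apply/funext => h; rewrite [h *: 1]mulr1 scalerDl addrCA.
by apply: DeriveDef; rewrite ?/derivable ?/derive E // -fl.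
Qed.

(** One mean value theorem in the direction [u], then one first order expansion of
    [f_u] at [x].  The derivative enters as a function [f_u] that agrees with the
    derivative of [f] near [x]: for an entry of a vector-valued map, such an
    [f_u] is the corresponding entry of the derivative, whose differentiability
    is then immediate. *)
Lemma second_difference_estimate (V : normedModType R) (f f_u : V -> R) (x u v : V) (e : R) :
    (\forall y \near x, is_derive y u f (f_u y)) -> differentiable f_u x -> 0 < e ->
  exists2 d : R, 0 < d & forall h : R, 0 < h -> h < d ->
    `|f (x + h *: u + h *: v) - f (x + h *: u) - f (x + h *: v) + f x
      - h ^+ 2 * 'D_v f_u x| <= e * h ^+ 2.
Proof.
move=> df ddf e0; set L := 'd f_u x.
rewrite deriveE //.
pose K : R := `|u| + `|v| + 1.
have K0 : 0 < K by rewrite ltr_wpDl // addr_ge0.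
pose eta := e / (2 * K); have eta0 : 0 < eta by rewrite divr_gt0 // mulr_gt0.
have err : \forall z \near (0 : V),
    `|f_u (x + z) - f_u x - L z| <= eta * `|z|.
  have /funext/eqaddoP/(_ _ eta0) := diff_locallyxC ddf.
  by apply: filterS => z; rewrite /= opprD addrA.
have df0 : \forall z \near (0 : V), is_derive (x + z) u f (f_u (x + z)).
  move: df; rewrite (near_shift 0) /=; apply: filterS => z.
  by rewrite /= subr0 addrC.
have [d /= d0 dP] := (nbhs_ballP _ _).1 (filterI err df0).
have ball_d z h : `|z| <= h * K -> h < d / K -> ball (0 : V) d z.
  move=> zh hd; rewrite -ball_normE /= sub0r normrN; apply: le_lt_trans zh _.
  by rewrite -ltr_pdivlMr.
exists (d / K); first exact: divr_gt0.
move=> h h0 hd; have h0' := ltW h0.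
have near1 t : 0 <= t <= h -> `|t *: u| <= h * K.
  move=> /andP[t0 th]; rewrite normrZ ger0_norm //.
  by apply: ler_pM; rewrite // /K -addrA lerDl addr_ge0.
have near2 t : 0 <= t <= h -> `|t *: u + h *: v| <= h * K.
  move=> /andP[t0 th]; apply: le_trans (ler_normD _ _) _.
  rewrite !normrZ (ger0_norm t0) (ger0_norm h0') /K !mulrDr mulr1.
  apply: (@le_trans _ _ (h * `|u| + h * `|v|)); last by rewrite lerDl.
  by rewrite lerD2r ler_wpM2r.
pose phi (t : R) := f (x + h *: v + t *: u) - f (x + t *: u).
pose dphi (t : R) := f_u (x + h *: v + t *: u) - f_u (x + t *: u).
have shiftE t : x + h *: v + t *: u = x + (t *: u + h *: v).
  by rewrite -addrA [h *: v + _]addrC.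
have Dphi t : t \in `[0, h] -> is_derive t (1 : R) phi (dphi t).
  move=> /itvP th; have t0h : 0 <= t <= h by rewrite !th.
  apply: is_deriveB.
    by apply: is_derive_line; rewrite shiftE; apply: (dP _ (ball_d _ _ (near2 _ t0h) hd)).2.
  by apply: is_derive_line; apply: (dP _ (ball_d _ _ (near1 _ t0h) hd)).2.
have [|t th] := MVT_segment h0' (fun t th => Dphi t (subset_itv_oo_cc th)).
  apply: derivable_within_continuous => t th.
  by have [] := Dphi t th.
rewrite subr0 => phiE.
have t0h : 0 <= t <= h by rewrite !(itvP th).
have -> : f (x + h *: u + h *: v) - f (x + h *: u) - f (x + h *: v) + f x
    = dphi t * h.
  rewrite -phiE /phi !scale0r !addr0 (addrAC x (h *: u)); ring.
have e1 := (dP _ (ball_d _ _ (near1 _ t0h) hd)).1.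
have e2 := (dP _ (ball_d _ _ (near2 _ t0h) hd)).1.
have Llin : L (t *: u + h *: v) = L (t *: u) + h * L v.
  by rewrite linearD [in X in _ + X]linearZ.
rewrite /= Llin in e2.
have -> : dphi t * h - h ^+ 2 * L v = h * ((f_u (x + (t *: u + h *: v))
    - f_u x - (L (t *: u) + h * L v)) - (f_u (x + t *: u) - f_u x - L (t *: u))).
  rewrite /dphi shiftE; ring.
rewrite normrM (ger0_norm h0') mulrC expr2 mulrA ler_wpM2r //.
apply: le_trans (ler_normB _ _) _.
have -> : e = eta * K + eta * K.
  by rewrite /eta; field; rewrite gt_eqF.
rewrite mulrDl; apply: lerD.
  apply: le_trans e2 _; rewrite -mulrA ler_wpM2l ?(ltW eta0) // [K * h]mulrC.
  exact: near2.
apply: le_trans e1 _; rewrite -mulrA ler_wpM2l ?(ltW eta0) // [K * h]mulrC.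
exact: near1.
Qed.

(** Symmetry of second derivatives: both are the limit of the same second
    difference quotient, because the second difference is symmetric in [u] and
    [v]. *)
Lemma derive_comm (V : normedModType R) (f f_u f_v : V -> R) (x u v : V) :
    (\forall y \near x, is_derive y u f (f_u y)) ->
    (\forall y \near x, is_derive y v f (f_v y)) ->
    differentiable f_u x -> differentiable f_v x ->
  'D_v f_u x = 'D_u f_v x.
Proof.
move=> du dv ddu ddv; apply/eqP; rewrite -subr_eq0 -normr_le0.
apply/ler_addgt0Pl => e e0; rewrite addr0.
have e20 : 0 < e / 2 by rewrite divr_gt0.
have [d1 d10 d1P] := @second_difference_estimate _ f f_u x u v _ du ddu e20.
have [d2 d20 d2P] := @second_difference_estimate _ f f_v x v u _ dv ddv e20.
pose h := Num.min d1 d2 / 2.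
have m0 : 0 < Num.min d1 d2 by rewrite lt_min d10.
have h0 : 0 < h by rewrite divr_gt0.
have : h < Num.min d1 d2 by rewrite /h; lra.
rewrite lt_min => /andP[h1 h2].
have := d2P h h0 h2; have := d1P h h0 h1.
rewrite (addrAC x (h *: v)).
set a := 'D_v _ x; set b := 'D_u _ x; set A := f (x + _ + _); set B := f (x + h *: u).
set C := f (x + h *: v) => le1 le2.
have hh : 0 < h ^+ 2 by rewrite exprn_gt0.
rewrite -(ler_pM2r hh) -[h ^+ 2 in leLHS](ger0_norm (ltW hh)) -normrM.
have -> : (a - b) * h ^+ 2 = (A - C - B + f x - h ^+ 2 * b) - (A - B - C + f x - h ^+ 2 * a).
  ring.
apply: le_trans (ler_normB _ _) _; lra.
Qed.

Lemma derive_entry (V : normedModType R) (m : nat) (f : V -> 'rV[R]_m) (x u : V) (k : 'I_m) :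
  derivable f x u -> ('D_u f x) 0 k = 'D_u (fun y => f y 0 k) x.
Proof. by move=> df; rewrite derive_mx // mxE. Qed.

Lemma derivable_entry (V : normedModType R) (m : nat) (f : V -> 'rV[R]_m) (x u : V) (k : 'I_m) :
  derivable f x u -> derivable (fun y => f y 0 k) x u.
Proof. by move=> /derivable_mxP/(_ 0 k). Qed.

Lemma differentiable_entry (V : normedModType R) (m : nat) (f : V -> 'rV[R]_m) (x : V) (k : 'I_m) :
  differentiable f x -> differentiable (fun y => f y 0 k) x.
Proof.
move=> df; apply: (@differentiable_comp _ _ _ _ f (fun A : 'rV[R]_m => A 0 k)) => //.
exact: differentiable_coord.
Qed.

Lemma partial_comm (n m : nat) (U : set 'rV[R]_n) (f : 'rV[R]_n -> 'rV[R]_m) (x : 'rV[R]_n)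
    (i j : 'I_n) : open U -> U x -> smooth_on U f ->
  partial i (partial j f) x = partial j (partial i f) x.
Proof.
move=> oU Ux sf.
have nearU : \forall y \near x, U y by exact: open_nbhs_nbhs.
have D k y : U y -> derivable f y (delta_mx 0 k).
  by move=> Uy; apply: diff_derivable; exact: (sf [::]).
have DD k : differentiable (partial k f) x by exact: (sf [:: k]).
have DE k l : \forall y \near x,
    is_derive y (delta_mx 0 l) (fun z => f z 0 k) (partial l f y 0 k).
  near=> y; have Uy : U y by near: y.
  by apply: DeriveDef; [exact/derivable_entry/D | rewrite -derive_entry //; exact: D].
have entryE k l i' : partial i' (partial l f) x 0 k =
    'D_(delta_mx 0 i') (fun y => partial l f y 0 k) x.
  exact/derive_entry/diff_derivable/DD.
apply/rowP => k; apply: etrans (entryE k j i) (etrans _ (esym (entryE k i j))).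
apply: (derive_comm (DE k j) (DE k i)); exact/differentiable_entry/DD.
Unshelve. all: by end_near. Qed.

Lemma row_jacobian (n m : nat) (f : 'rV[R]_n -> 'rV[R]_m) (x : 'rV[R]_n) (i : 'I_n) :
  differentiable f x -> row i ('J f x) = partial i f x.
Proof. by move=> df; rewrite rowE -deriveEjacobian. Qed.

Lemma jacobian_comp_near (n p m : nat) (f : 'rV[R]_n -> 'rV[R]_m)
    (h : 'rV[R]_n -> 'rV[R]_p) (g : 'rV[R]_p -> 'rV[R]_m) (x : 'rV[R]_n) :
    (\forall y \near x, f y = g (h y)) ->
    differentiable f x -> differentiable h x -> differentiable g (h x) ->
  'J f x = 'J h x *m 'J g (h x).
Proof.
move=> fgh df dh dg; apply/row_matrixP => i.
rewrite row_jacobian // row_mul row_jacobian // -deriveEjacobian //.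
rewrite /partial (near_eq_derive _ fgh) deriveE; last exact: differentiable_comp.
by rewrite diff_comp //= deriveE // deriveE.
Qed.

Lemma derive_dot (V : normedModType R) (m : nat) (f g : V -> 'rV[R]_m) (x u : V) :
    derivable f x u -> derivable g x u ->
  'D_u (fun y => dot (f y) (g y)) x = dot ('D_u f x) (g x) + dot (f x) ('D_u g x).
Proof.
move=> df dg; rewrite /dot.
have -> : (fun y => \sum_(i < m) f y 0 i * g y 0 i) =
    \sum_(i < m) ((fun y => f y 0 i) * (fun y => g y 0 i)).
  by apply/funext => y; rewrite fct_sumE.
rewrite derive_sum => [|i]; last by apply: derivableM; exact: derivable_entry.
rewrite -big_split; apply: eq_bigr => i _.
rewrite deriveM; try exact: derivable_entry.
by rewrite -!derive_entry // addrC; congr (_ + _); rewrite mulrC.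
Qed.
End Calculus.

Lemma cvg_det (R : realType) (T : Type) (H : set_system T) {FH : Filter H} (n : nat)
    (f : T -> 'M[R]_n) (L : 'M[R]_n) :
    (forall i j, (f x i j @[x --> H] --> L i j)%classic) ->
  (\det (f x) @[x --> H] --> \det L)%classic.
Proof.
move=> fL; apply: cvg_big => [|s _]; first exact: add_continuous.
apply: cvgMr; apply: cvg_big => [|i _]; first exact: mul_continuous.
exact: fL.
Qed.

Lemma cvg_differentiable_entry (R : realType) (V : normedModType R) (m : nat)
    (f : V -> 'rV[R]_m) (x : V) (k : 'I_m) :
  differentiable f x -> (f y 0 k @[y --> x] --> f x 0 k)%classic.
Proof.
by move=> df; exact: (differentiable_continuous (differentiable_entry k df)).
Qed.

Lemma cvg_dot (R : realType) (T : Type) (H : set_system T) {FH : Filter H} (m : nat)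
    (f g : T -> 'rV[R]_m) (u v : 'rV[R]_m) :
    (forall k, (f x 0 k @[x --> H] --> u 0 k)%classic) ->
    (forall k, (g x 0 k @[x --> H] --> v 0 k)%classic) ->
  (dot (f x) (g x) @[x --> H] --> dot u v)%classic.
Proof.
move=> fu gv; apply: cvg_big => [|k _]; first exact: add_continuous.
by apply: cvgM; [exact: fu | exact: gv].
Qed.

(** * Geometry of the hypersurface *)

Lemma gram_rows (R : realType) (n m : nat) (X Y : 'M[R]_(n, m)) :
  \matrix_(i, j) dot (row i X) (row j Y) = X *m Y^T.
Proof.
by apply/matrixP => i j; rewrite !mxE; apply: eq_bigr => k _; rewrite !mxE.
Qed.

Section Hypersurface.
Variables (R : realType) (n : nat) (M : topologicalType) (A : smooth_atlas R n M).
Variables (F nu : M -> 'rV[R]_n.+2).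
Hypotheses (hF : hypersurface_of_sphere A F) (hnu : unit_normal_field A F nu).

Local Notation JF c x := ('J (F \o param c) x).
Local Notation Jnu c x := ('J (nu \o param c) x).

Lemma near_img (c : chart A) (x : 'rV[R]_n) : img c x -> \forall y \near x, img c y.
Proof. by move=> cx; apply: open_nbhs_nbhs; split => //; exact: open_img. Qed.

Lemma first_fundamental_formE (c : chart A) (x : 'rV[R]_n) : img c x ->
  first_fundamental_form F c x = JF c x *m (JF c x)^T.
Proof.
move=> cx; have dF : differentiable (F \o param c) x by have [sF _ _] := hF; exact: (sF c [::]).
rewrite -gram_rows //; apply/matrixP => i j.
by rewrite !mxE !row_jacobian.
Qed.

Lemma first_fundamental_form_unit (c : chart A) (x : 'rV[R]_n) : img c x ->
  first_fundamental_form F c x \in unitmx.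
Proof.
by move=> cx; rewrite first_fundamental_formE // gram_unitmx //; have [_ _] := hF; apply.
Qed.

(** The derivative of [<d_j F, nu> = 0].  This form of [II] contains no second
    derivative, so it transforms under a change of chart by the chain rule
    alone. *)
Lemma second_fundamental_formE (c : chart A) (x : 'rV[R]_n) : img c x ->
  second_fundamental_form F nu c x = - (Jnu c x *m (JF c x)^T).
Proof.
move=> cx; have [sF _ _] := hF; have [snu _ _ orth] := hnu.
have dF : differentiable (F \o param c) x by exact: (sF c [::]).
have dnu : differentiable (nu \o param c) x by exact: (snu c [::]).
rewrite -gram_rows //; apply/matrixP => i j; rewrite !mxE !row_jacobian //.
have ddF : differentiable (partial j (F \o param c)) x by exact: (sF c [:: j]).
have := @derive_dot R _ _ (partial j (F \o param c)) (nu \o param c) x (delta_mx 0 i)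
  (diff_derivable ddF) (diff_derivable dnu).
rewrite (near_eq_derive (g := fun=> 0)); last first.
  near=> y; rewrite -[RHS](orth c y j); last by near: y; exact: near_img.
  by rewrite /dot; apply: eq_bigr => k _; rewrite mulrC.
rewrite derive_cst => /esym/eqP; rewrite addr_eq0 => /eqP -> /=.
by congr (- _); apply: eq_bigr => k _; rewrite mulrC.
Unshelve. all: by end_near. Qed.

Lemma second_fundamental_form_sym (c : chart A) (x : 'rV[R]_n) : img c x ->
  (second_fundamental_form F nu c x)^T = second_fundamental_form F nu c x.
Proof.
move=> cx; have [sF _ _] := hF; apply/matrixP => i j; rewrite !mxE.
by rewrite (partial_comm _ _ (@open_img _ _ _ A c) cx (sF c)).
Qed.

Lemma char_poly_shape_operator_splits (c : chart A) (x : 'rV[R]_n) : img c x ->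
  exists r : seq R, char_poly (shape_operator F nu c x) = \prod_(z <- r) ('X - z%:P).
Proof.
move=> cx; rewrite /shape_operator first_fundamental_formE //.
apply: pencil_char_poly_splits; last exact: second_fundamental_form_sym.
by have [_ _] := hF; apply.
Qed.

Lemma jacobian_transition (m : nat) (G : M -> 'rV[R]_m) (c d : chart A) (x : 'rV[R]_n) :
    smooth_map A G -> img c x -> dom d (param c x) ->
  'J (G \o param c) x
  = 'J (coord d \o param c) x *m 'J (G \o param d) (coord d (param c x)).
Proof.
move=> sG cx dx.
apply: jacobian_comp_near.
- near=> y => /=; rewrite coordK //; near: y.
  by apply: (param_continuous cx); apply: open_nbhs_nbhs; split => //; exact: open_dom.
- exact: (sG c [::]).
- by apply: (@transition_smooth _ _ _ A c d [::]).
- by apply: (sG d [::]); exact: coord_img.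
Unshelve. all: by end_near. Qed.

(** Both fundamental forms in the chart [c] are congruent to those in the chart
    [d] through the Jacobian matrix [T] of the transition map.  It is invertible
    because [JF c] factors through it and has full rank. *)
Lemma char_poly_shape_operator_chart (c d : chart A) (p : M) : dom c p -> dom d p ->
  char_poly (shape_operator F nu c (coord c p)) = char_poly (shape_operator F nu d (coord d p)).
Proof.
move=> cp dp; have [sF _ Ffree] := hF; have [snu _ _ _] := hnu.
have cx := coord_img cp; have dx := coord_img dp.
have dcx : dom d (param c (coord c p)) by rewrite coordK.
have JFE := jacobian_transition sF cx dcx; have JnuE := jacobian_transition snu cx dcx.
rewrite coordK // in JFE JnuE.
set T := 'J (coord d \o param c) (coord c p) in JFE JnuE.
have Tunit : T \in unitmx.
  rewrite -row_free_unit -row_leq_rank; have := Ffree c _ cx.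
  by rewrite JFE -row_leq_rank => /leq_trans; apply; exact: mxrankM_maxl.
have IE : first_fundamental_form F c (coord c p)
    = T *m first_fundamental_form F d (coord d p) *m T^T.
  by rewrite !first_fundamental_formE // JFE trmx_mul !mulmxA.
have IIE : second_fundamental_form F nu c (coord c p)
    = T *m second_fundamental_form F nu d (coord d p) *m T^T.
  by rewrite !second_fundamental_formE // JFE JnuE trmx_mul mulmxN mulNmx !mulmxA.
rewrite /shape_operator IE IIE; apply: char_poly_congruence => //.
exact: first_fundamental_form_unit.
Qed.

(** The value is a quotient of determinants of matrices with continuous
    entries. *)
Lemma cvg_char_poly_shape_operator (c : chart A) (x : 'rV[R]_n) (l : R) : img c x ->
  ((char_poly (shape_operator F nu c y)).[l] @[y --> x]
     --> (char_poly (shape_operator F nu c x)).[l])%classic.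
Proof.
move=> cx; have [sF _ _] := hF; have [snu _ _ _] := hnu.
have cI i j : (first_fundamental_form F c y i j @[y --> x]
    --> first_fundamental_form F c x i j)%classic.
  under eq_fun do rewrite mxE.
  rewrite mxE; apply: (cvg_dot (H := nbhs x)) => k; apply: cvg_differentiable_entry.
    exact: (sF c [:: i]).
  exact: (sF c [:: j]).
have cII i j : (second_fundamental_form F nu c y i j @[y --> x]
    --> second_fundamental_form F nu c x i j)%classic.
  under eq_fun do rewrite mxE.
  rewrite mxE; apply: (cvg_dot (H := nbhs x)) => k.
    by apply: cvg_differentiable_entry; exact: (sF c [:: i; j]).
  by apply: (cvg_differentiable_entry (f := nu \o param c)); exact: (snu c [::]).
rewrite /shape_operator horner_char_poly ?first_fundamental_form_unit //.
pose h y := \det (l *: first_fundamental_form F c y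
  - second_fundamental_form F nu c y) / \det (first_fundamental_form F c y).
have hE : \forall y \near x, h y = (char_poly (shape_operator F nu c y)).[l].
  near=> y; rewrite /shape_operator horner_char_poly //.
  by apply: first_fundamental_form_unit; near: y; exact: near_img.
apply: cvg_trans (near_eq_cvg hE) _; rewrite /h.
apply: cvgM; last first.
  apply: cvgV; last exact: (cvg_det (H := nbhs x)).
  by rewrite -unitfE -unitmxE first_fundamental_form_unit.
have entryE i j y : (l *: first_fundamental_form F c y - second_fundamental_form F nu c y) i j
    = l * first_fundamental_form F c y i j - second_fundamental_form F nu c y i j.
  by rewrite !mxE.
apply: (cvg_det (H := nbhs x)) => i j; under eq_fun do rewrite entryE.
by rewrite entryE; apply: cvgB; [apply: cvgMr; exact: cI | exact: cII].
Unshelve. all: by end_near. Qed.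

End Hypersurface.

(** * Local constancy of the curvatures *)

Lemma locally_constant_connected (T : topologicalType) (X : Type) (f : T -> X) :
    connected [set: T] -> (forall p, \forall q \near p, f q = f p) ->
  forall p q, f q = f p.
Proof.
move=> cT lc p q.
have open_fiber (Y : set X) : open (f @^-1` Y)%classic.
  by rewrite openE => z /= Yz; near=> w; rewrite /= (near (lc z) w).
have -> : f q = f p; last by [].
have : ([set z | f z = f p] = [set: T])%classic.
  apply: cT; first by exists p.
  - exists [set z | f z = f p]%classic; last by rewrite setTI.
    exact: (open_fiber [set f p]%classic).
  - exists [set z | f z = f p]%classic; last by rewrite setTI.
    rewrite -openC; exact: (open_fiber (~` [set f p])%classic).
by move=> /seteqP[_ /(_ q I)].
Unshelve. all: by end_near. Qed.

Theorem corollary1p2 (R : realType) (n : nat) (M : topologicalType)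
    (A : smooth_atlas R n M) (F nu : M -> 'rV[R]_n.+2) (g : nat)
    (hM : closed_connected_manifold M)
    (hF : hypersurface_of_sphere A F)
    (hnu : unit_normal_field A F nu)
    (hg : forall p : M, size (undup (principal_curvatures A F nu p)) = g)
    (hgn : (g < n)%N)
    (hk : forall k : nat, (1 <= k <= g)%N ->
      exists c : R, forall p : M,
        \sum_(l <- principal_curvatures A F nu p) l ^+ k = c) :
  isoparametric A F nu.
Proof.
set pc := principal_curvatures A F nu.
have [_ _ cM] := hM.
pose S p := shape_operator F nu (chart_at A p) (coord (chart_at A p) p).
have chiE p : char_poly (S p) = \prod_(l <- pc p) ('X - l%:P).
  apply/char_poly_real_eigenvalues/char_poly_shape_operator_splits => //.
  by apply: coord_img; exact: dom_chart_at.
have size_pc p : size (pc p) = n.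
  by apply/eqP; rewrite -eqSS -(size_char_poly (S p)) chiE size_prod_XsubC.
(* For k = 0 this says that all points have n curvatures, which relies on the
   characteristic polynomials having only real roots. *)
have power_sums p q k : (k <= g)%N ->
    \sum_(l <- pc q) l ^+ k = \sum_(l <- pc p) l ^+ k.
  case: k => [_|k kg]; last by have [c hc] := hk k.+1 kg; rewrite !hc.
  by under eq_bigr do rewrite expr0; under [RHS]eq_bigr do rewrite expr0;
    rewrite !big_const_seq !count_predT !size_pc.
suff lc p : \forall q \near p, pc q = pc p.
  have [[p _]|empty] := pselect (exists p : M, True).
    by exists (pc p) => q; exact: (locally_constant_connected cM lc).
  by exists [::] => q; case: empty; exists q.
have [e e0 isolated] := power_sums_isolated (pc p).
have en : 0 < e ^+ n by rewrite exprn_gt0.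
pose c := chart_at A p.
have cp : dom c p by exact: dom_chart_at.
have near_dom : \forall q \near p, dom c q.
  by apply: open_nbhs_nbhs; split => //; exact: open_dom.
(* The characteristic polynomial at q, read in the fixed chart c around p, is
   continuous in q and vanishes at the curvatures of p. *)
have near_roots : \forall q \near p, forall i : 'I_(size (pc p)),
    `|(char_poly (S q)).[(pc p)`_i]| < e ^+ n.
  apply: filter_forall => i.
  have := cvg_comp _ _ (coord_continuous cp)
    (cvg_char_poly_shape_operator hF hnu (l := (pc p)`_i) (coord_img cp)).
  have -> : (char_poly (shape_operator F nu c (coord c p))).[(pc p)`_i] = 0.
    by apply/eqP; rewrite -/(root _ _) -/(S p) chiE root_prod_XsubC mem_nth.
  move=> /cvgr0Pnorm_lt/(_ _ en) H; near=> q.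
  rewrite (char_poly_shape_operator_chart hF hnu (dom_chart_at A q) (_ : dom c q)).
    by near: q.
  by near: q.
near=> q.
have perm_q : perm_eq (pc q) (pc p).
  apply: isolated => [|k|l lp]; rewrite ?hg //; first exact: power_sums.
  have lt_e : `|(char_poly (S q)).[l]| < e ^+ size (pc q).
    have [i ip <-] := nthP 0 lp; rewrite size_pc.
    by have := near near_roots q; move=> /(_ _ (Ordinal ip)); apply.
  apply: root_near; rewrite ?(ltW e0) -?chiE //.
  by rewrite size_pc; case: (n) hgn.
rewrite /pc /principal_curvatures /real_eigenvalues.
by rewrite -/(S q) -/(S p) !chiE (perm_big _ perm_q).
Unshelve. all: by end_near. Qed.
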